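(* Let $\{f_t\mid t\geq 0\}$ be an infinitely divisible collection of symmetric tradeoff functions, and let $F$ be the log-concave canonical noise distribution (CND) for $f_1$. Let $N\sim F$ and let $N'$ be any real-valued random variable such that $T(N',N'+t)\geq f_t$ for all $t\geq 0$. Then $|N'-a|$ stochastically dominates $|N|$ for all $a\in\mathbb{R}$. It follows that: - $P(|N|\leq t)\geq P(|N'-a|\leq t)$ for all $a\in\mathbb{R}$ and all real $t\geq 0$; - for any non-decreasing function $\phi$, $\mathbb{E}\,\phi(|N|)\leq\mathbb{E}\,\phi(|N'-a|)$ for all $a\in\mathbb{R}$; - there exists a non-negative random variable $W$ such that $|N'|\overset{d}{=}|N|+W$; if $N'$ is symmetric about zero, then $N'\overset{d}{=}N+\mathrm{sign}(N)\cdot W$.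
   Context: For probability distributions $P,Q$ on a common measurable space, the tradeoff function $T(P,Q):[0,1]\to[0,1]$ is $T(P,Q)(\alpha)=\inf\{1-\mathbb{E}_Q(\phi)\mid \mathbb{E}_P(\phi)\leq 1-\alpha\}$, the infimum over measurable tests $\phi$ with values in $[0,1]$. For random variables $X,Y$, $T(X,Y)$ denotes the tradeoff function of their laws. A function $f:[0,1]\to[0,1]$ is a tradeoff function if $f=T(P,Q)$ for some $P,Q$; equivalently, $f$ is convex, continuous, non-decreasing, and $f(x)\leq x$ for all $x\in[0,1]$. It is nontrivial if $f(\alpha)<\alpha$ for some $\alpha\in(0,1)$, and symmetric if $f=T(P,Q)$ implies $f=T(Q,P)$. Inequalities between functions are pointwise. Canonical noise distribution: let $f$ be a symmetric tradeoff function and $N$ a continuous real random variable (continuous cdf) with cdf $F$. Then $F$ (or $N$) is a canonical noise distribution (CND) for $f$ if (1) $T(N,N+m)\geq f$ for all $m\in[0,1]$; (2) $f(\alpha)=T(N,N+1)(\alpha)$ for all $\alpha\in(0,1)$; (3) $T(N,N+1)(\alpha)=F(F^{-1}(\alpha)-1)$ for all $\alpha\in(0,1)$, where $F^{-1}$ is the quantile function; (4) $F(x)=1-F(-x)$ for all $x\in\mathbb{R}$. A collection $\{f_t\mid t\geq 0\}$ of tradeoff functions is infinitely divisible if (1) $f_s\circ f_t=f_{s+t}$ for all $s,t\geq 0$; (2) $f_s$ is nontrivial for all $s>0$; (3) $f_s\to f_0=\mathrm{Id}$ as $s\downarrow 0$, where $\mathrm{Id}(\alpha)=\alpha$. A continuous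 random variable is log-concave if it has a density of the form $g(x)\propto\exp(C(x))$ with $C$ concave. It is a known result (Awan and Dong, 2022) that for an infinitely divisible collection there is a unique log-concave distribution with cdf $F$ such that, for every $t>0$, $x\mapsto F(tx)$ is a CND for $f_t$; this $F$ is what is meant by ''the log-concave CND for $f_1$''. $X$ stochastically dominates $Y$ if $P(X\leq t)\leq P(Y\leq t)$ for all $t\in\mathbb{R}$. $W$ is allowed to depend on $N$ (it is defined jointly with a copy of $N$ on a suitable probability space). $\overset{d}{=}$ is equality in distribution. Expectations are allowed to be $+\infty$. *)

(* Defs.v *)
Set Warnings "-notation-overridden,-notation-incompatible-prefix,-ambiguous-paths".
From HB Require Import structures.
From mathcomp Require Import all_boot all_order all_algebra.
From mathcomp Require Import all_classical all_reals all_analysis.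
From mathcomp Require Import measurable_realfun.

Set Implicit Arguments.
Unset Strict Implicit.
Unset Printing Implicit Defensive.

Import Order.TTheory GRing.Theory Num.Theory.
Import numFieldNormedType.Exports.

Local Open Scope classical_set_scope.
Local Open Scope ring_scope.

(* The real infimum is meaningful for 0 <= a <= 1, where the set is non-empty
   (constant test 1 - a) and bounded below by 0. Elsewhere the value is junk,
   and every predicate below restricts its argument to [0, 1]. *)
Definition tradeoff (R : realType) (d : measure_display) (T : measurableType d)
    (P Q : probability T R) (a : R) : R :=
  inf [set 1 - fine 'E_Q[phi] | phi in
        [set phi : {mfun T >-> R} |
          (forall x, 0 <= phi x <= 1) /\ ('E_P[phi] <= (1 - a)%:E)%E]].

Definition tradeoff_shift (R : realType) (d : measure_display)
    (T : measurableType d) (P : probability T R) (X : {RV P >-> R}) (m : R) :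
    R -> R :=
  tradeoff (distribution P X) (distribution P (X \+ cst m)).

(* A function [0, 1] -> [0, 1] is represented by a function R -> R of which only
   the values on [0, 1] matter. *)
Definition is_tradeoff_of (R : realType) (d : measure_display)
    (T : measurableType d) (P Q : probability T R) (f : R -> R) : Prop :=
  forall a : R, 0 <= a <= 1 -> f a = tradeoff P Q a.

Definition tradeoff_function (R : realType) (f : R -> R) : Prop :=
  exists (d : measure_display) (T : measurableType d) (P Q : probability T R),
    is_tradeoff_of P Q f.

Definition nontrivial_tradeoff (R : realType) (f : R -> R) : Prop :=
  exists2 a : R, 0 < a < 1 & f a < a.

Definition symmetric_tradeoff (R : realType) (f : R -> R) : Prop :=
  forall (d : measure_display) (T : measurableType d) (P Q : probability T R),
    is_tradeoff_of P Q f -> is_tradeoff_of Q P f.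

(* Only the members f t with 0 <= t belong to the collection. *)
Record infinitely_divisible (R : realType) (f : R -> R -> R) : Prop := {
  infdiv_tradeoff : forall t : R, 0 <= t -> tradeoff_function (f t);
  infdiv_comp : forall s t : R, 0 <= s -> 0 <= t ->
    forall a : R, 0 <= a <= 1 -> f s (f t a) = f (s + t) a;
  infdiv_nontrivial : forall s : R, 0 < s -> nontrivial_tradeoff (f s);
  infdiv_id : forall a : R, 0 <= a <= 1 -> f 0 a = a;
  infdiv_cvg : forall a : R, 0 <= a <= 1 -> f s a @[s --> 0^'+] --> f 0 a
}.

Definition has_cdf (R : realType) (d : measure_display) (T : measurableType d)
    (P : probability T R) (X : {RV P >-> R}) (F : R -> R) : Prop :=
  forall x : R, cdf X x = (F x)%:E.

Definition quantile (R : realType) (F : R -> R) (a : R) : R :=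
  inf [set x | a <= F x].

Record cnd_rv (R : realType) (d : measure_display) (T : measurableType d)
    (P : probability T R) (f : R -> R) (N : {RV P >-> R}) (F : R -> R) :
    Prop := {
  cnd_cdf : has_cdf N F;
  cnd_continuous : continuous F;
  cnd_ge : forall m : R, 0 <= m <= 1 ->
    forall a : R, 0 <= a <= 1 -> f a <= tradeoff_shift N m a;
  cnd_tight : forall a : R, 0 < a < 1 -> f a = tradeoff_shift N 1 a;
  cnd_quantile : forall a : R, 0 < a < 1 ->
    tradeoff_shift N 1 a = F (quantile F a - 1);
  cnd_symmetric : forall x : R, F x = 1 - F (- x)
}.

Definition cnd (R : realType) (f F : R -> R) : Prop :=
  [/\ tradeoff_function f, symmetric_tradeoff f &
    exists (d : measure_display) (T : measurableType d) (P : probability T R)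
      (N : {RV P >-> R}), cnd_rv f N F].

(* Concave functions may take the value -oo (but not +oo), so that log-concave
   densities may vanish outside an interval, as for uniform distributions. *)
Definition concave_ereal (R : realType) (C : R -> \bar R) : Prop :=
  (forall x, (C x < +oo)%E) /\
  forall (x y t : R), 0 < t < 1 ->
    (t%:E * C x + (1 - t)%:E * C y <= C (t * x + (1 - t) * y)%R)%E.

Definition has_density (R : realType) (d : measure_display)
    (T : measurableType d) (P : probability T R) (X : {RV P >-> R})
    (g : R -> R) : Prop :=
  [/\ measurable_fun setT g, forall x, 0 <= g x &
    forall A : set R, measurable A ->
      distribution P X A = (\int[lebesgue_measure]_(x in A) (g x)%:E)%E].

Definition log_concave_rv (R : realType) (d : measure_display)
    (T : measurableType d) (P : probability T R) (X : {RV P >-> R}) : Prop :=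
  exists (g : R -> R) (C : R -> \bar R) (c : R),
    [/\ has_density X g, concave_ereal C, 0 < c &
      forall x, (g x)%:E = (c%:E * expeR (C x))%E].

Definition log_concave (R : realType) (F : R -> R) : Prop :=
  exists (d : measure_display) (T : measurableType d) (P : probability T R)
    (X : {RV P >-> R}), has_cdf X F /\ log_concave_rv X.

(* For an infinitely divisible collection f there is exactly one such F, called
   the log-concave CND for f 1. *)
Definition log_concave_cnd (R : realType) (f : R -> R -> R) (F : R -> R) :
    Prop :=
  log_concave F /\ forall t : R, 0 < t -> cnd (f t) (fun x => F (t * x)).

Definition stochastically_dominates (R : realType) (d d' : measure_display)
    (T : measurableType d) (T' : measurableType d') (P : probability T R)
    (P' : probability T' R) (X : T -> R) (Y : T' -> R) : Prop :=
  forall t : R, (P [set w | X w <= t]%R <= P' [set w | Y w <= t]%R)%E.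

Definition eq_in_distribution (R : realType) (d d' : measure_display)
    (T : measurableType d) (T' : measurableType d') (P : probability T R)
    (P' : probability T' R) (X : T -> R) (Y : T' -> R) : Prop :=
  forall A : set R, measurable A -> pushforward P X A = pushforward P' Y A.

Definition symmetric_about_zero (R : realType) (d : measure_display)
    (T : measurableType d) (P : probability T R) (X : T -> R) : Prop :=
  eq_in_distribution P P X (fun w => - X w).

(* Main.v *)
Require Import Defs.
Set Warnings "-notation-overridden,-notation-incompatible-prefix,-ambiguous-paths".
From HB Require Import structures.
From mathcomp Require Import all_boot all_order all_algebra.
From mathcomp Require Import all_classical all_reals all_analysis.
From mathcomp Require Import measurable_realfun.
From mathcomp Require Import lra.
Import Order.TTheory GRing.Theory Num.Theory.
Import numFieldNormedType.Exports.
Local Open Scope classical_set_scope.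
Local Open Scope ring_scope.

(** Write Delta(a) = a - f_s(a) with s = 2t > 0. The threshold tests 1{x > u}
give H(u) - H(u - s) <= Delta(H(u)) for the cdf H of N', so the mass that N'
puts on an interval of length 2t is at most sup Delta. For the CND itself,
f_s(F(x)) = F(x - s), so the symmetry of F makes Delta take the same value
at F(x) and F(s - x), and F(t) lies between these two points. Tradeoff functions
are convex, hence Delta is concave and is maximal at F(t), where its value is
F(t) - F(-t) = P(|N| <= t). The coupling is the monotone rearrangement of |N|
into |N'|, W being the displacement. *)

(** * Expectations of tests and convexity of tradeoff functions *)

Section Tradeoff.
Context {R : realType} {d : measure_display} {T : measurableType d}.
Implicit Types (P Q : probability T R) (phi psi : {mfun T >-> R}) (a b l : R).

Definition is_test phi := forall x, 0 <= phi x <= 1.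

Lemma test_integrable P phi :
  is_test phi -> P.-integrable setT (EFin \o phi).
Proof.
move=> t01; apply: measurable_bounded_integrable => //.
  by rewrite (@le_lt_trans _ _ 1%E) ?probability_le1// ltry.
exists 1; split; first exact: num_real.
move=> M M1 x _ /=; have /andP[x0 x1] := t01 x.
by rewrite ger0_norm// (le_trans x1)// ltW.
Qed.

Lemma fine_expectation P phi : is_test phi -> (fine 'E_P[phi])%:E = 'E_P[phi]%E.
Proof.
move=> /(test_integrable P) h; rewrite fineK// unlock.
exact: integrable_fin_num.
Qed.

Lemma fine_expectation01 P phi : is_test phi -> 0 <= fine 'E_P[phi] <= 1.
Proof.
move=> t01; rewrite -!lee_fin fine_expectation// expectation_ge0; last first.
  by move=> x; case/andP: (t01 x).
rewrite /= -(expectation_cst P 1).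
apply: expectation_le => //.
- by move=> x; case/andP: (t01 x).
- by apply: aeW => x; case/andP: (t01 x).
Qed.

Lemma has_inf_tradeoff P Q a : 0 <= a <= 1 ->
  has_inf [set 1 - fine 'E_Q[phi] | phi in
    [set phi : {mfun T >-> R} |
      (forall x, 0 <= phi x <= 1) /\ ('E_P[phi] <= (1 - a)%:E)%E]].
Proof.
move=> a01; split; last first.
  by exists 0 => _ [phi [t01 _] <-]; have := fine_expectation01 Q _ t01; lra.
exists (1 - fine 'E_Q[cst (1 - a)]); exists (cst (1 - a)) => //.
by split; [move=> x /=; lra|rewrite expectation_cst].
Qed.

Lemma tradeoff_le P Q a phi : is_test phi ->
  ('E_P[phi] <= (1 - a)%:E)%E -> tradeoff P Q a <= 1 - fine 'E_Q[phi].
Proof.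
move=> t01 Pphi; apply: ge_inf; last by exists phi.
by exists 0 => _ [psi [psi01 _] <-]; have := fine_expectation01 Q _ psi01; lra.
Qed.

(** Mixing tests that are near-optimal at [a] and [b] with weights [l] and [1 - l] gives a test
    admissible at the mixed level, and expectation is linear. The slack [e] replaces attainment of
    the infimum. *)
Lemma tradeoff_convex P Q a b l :
  0 <= a <= 1 -> 0 <= b <= 1 -> 0 <= l <= 1 ->
  tradeoff P Q (l * a + (1 - l) * b) <=
  l * tradeoff P Q a + (1 - l) * tradeoff P Q b.
Proof.
move=> a01 b01 l01; apply/ler_addgt0Pr => e e0.
have [l0 l1] : 0 <= l /\ 0 <= 1 - l by split; lra.
have [_ [phi [tphi Pphi] <-]] := inf_adherent e0 (has_inf_tradeoff P Q _ a01).
have [_ [psi [tpsi Ppsi] <-]] := inf_adherent e0 (has_inf_tradeoff P Q _ b01).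
rewrite -/(tradeoff P Q a) -/(tradeoff P Q b) => hpsi hphi.
pose chi : {mfun T >-> R} := cst l \* phi \+ cst (1 - l) \* psi.
have tchi : is_test chi.
  by move=> x; rewrite /chi /=; have := tphi x; have := tpsi x; nra.
have Echi (S : probability T R) :
    'E_S[chi]%E = (l * fine 'E_S[phi] + (1 - l) * fine 'E_S[psi])%:E.
  rewrite EFinD !EFinM !fine_expectation// unlock /chi /=.
  have iphi := test_integrable S _ tphi; have ipsi := test_integrable S _ tpsi.
  rewrite -!integralZl// -integralD//; exact: integrableZl.
have : tradeoff P Q (l * a + (1 - l) * b) <= 1 - fine 'E_Q[chi].
  apply: tradeoff_le => //; rewrite Echi lee_fin.
  move: Pphi Ppsi.
  rewrite -(fine_expectation P phi)// -(fine_expectation P psi)// !lee_fin.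
  move=> /(ler_wpM2l l0) + /(ler_wpM2l l1); lra.
move: hphi hpsi => /ltW/(ler_wpM2l l0) + /ltW/(ler_wpM2l l1).
by rewrite Echi /=; lra.
Qed.

End Tradeoff.

(** * Distribution functions and quantiles *)

Section Cdf.
Context {R : realType} {d : measure_display} {T : measurableType d}.
Context {P : probability T R} {X : {RV P >-> R}} {F : R -> R}.
Hypothesis hF : has_cdf X F.

Lemma cdf_homo x y : x <= y -> F x <= F y.
Proof. by move=> xy; rewrite -lee_fin -!hF cdf_nondecreasing. Qed.

Lemma cdf01 x : 0 <= F x <= 1.
Proof. by rewrite -!lee_fin -hF cdf_ge0 cdf_le1. Qed.

Lemma cdf_gtr x : P (X @^-1` `]x, +oo[) = (1 - F x)%:E.
Proof.
rewrite EFinB -hF -setCitvl -preimage_setC probability_setC//.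
by apply: (measurable_funPTI X); exact: measurable_itv.
Qed.

Lemma cdf_itv_oc x y : x <= y -> P (X @^-1` `]x, y]) = (F y - F x)%:E.
Proof.
move=> xy; have -> : `]x, y]%classic = `]-oo, y] `\` `]-oo, x].
  by rewrite -[RHS]setCK setCD setCitvl setUC -[LHS]setCK setCitv.
have -> : X @^-1` (`]-oo, y] `\` `]-oo, x]) =
    X @^-1` `]-oo, y] `\` X @^-1` `]-oo, x] by [].
rewrite EFinB -!hF measureD; last 3 first.
- by apply: (measurable_funPTI X); exact: measurable_itv.
- by apply: (measurable_funPTI X); exact: measurable_itv.
- rewrite -ge0_fin_numE// fin_num_measure//.
  by apply: (measurable_funPTI X); exact: measurable_itv.
congr (_ - P _)%E; rewrite -preimage_setI; congr (_ @^-1` _).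
by rewrite setIidr//; exact: subset_itvl.
Qed.

Lemma cdf_eventually_gt a : a < 1 -> exists x, a < F x.
Proof.
move=> a1; have : cdf X x @[x --> +oo] --> 1%E by exact: cvg_cdfy1.
move=> /fine_cvg/cvgr_gt => /(_ _ a1) /filter_ex[x /=].
by rewrite hF; exists x.
Qed.

Lemma cdf_eventually_lt a : 0 < a -> exists x, F x < a.
Proof.
move=> a0; have : cdf X x @[x --> -oo] --> 0%E by exact: cvg_cdfNy0.
move=> /fine_cvg/cvgr_lt => /(_ _ a0) /filter_ex[x /=].
by rewrite hF; exists x.
Qed.

(** By right-continuity of the cdf the infimum is attained, which makes quantile and cdf a Galois
    pair. At level 0 the set is the whole line and at level 1 it may be empty, hence the strict
    bounds on [v]. *)
Lemma quantile_leE (v t : R) : 0 < v < 1 -> (quantile F v <= t) = (v <= F t).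
Proof.
move=> /andP[v0 v1]; have [x /ltW vx] := cdf_eventually_gt _ v1.
have [y Fy] := cdf_eventually_lt _ v0.
have lb z : F z < v -> lbound [set x | v <= F x] z.
  move=> Fz u /= vu; rewrite leNgt; apply/negP => /ltW/cdf_homo.
  by rewrite leNgt (lt_le_trans Fz vu).
apply/idP/idP => [qt|vt]; last by apply: ge_inf => //; exists y; exact: lb.
(* If [F] were below [v] at the quantile, it would still be so at some point to its right, a lower
   bound exceeding the infimum. *)
apply: le_trans (cdf_homo _ _ qt); rewrite leNgt; apply/negP => Fq.
have : fine (cdf X z) @[z --> (quantile F v)^'+] -->
    fine (cdf X (quantile F v)).
  apply: fine_cvg; rewrite fineK; first exact: cdf_right_continuous.
  by rewrite hF.
rewrite [in X in _ --> X]hF /= => /cvgr_lt/(_ _ Fq) h.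
have : \forall z \near (quantile F v)^'+, quantile F v < z /\ F z < v.
  near=> z; split; first by near: z; exact: nbhs_right_gt.
  have -> : F z = fine (cdf X z) by rewrite hF.
  by near: z.
move=> /filter_ex[z [/= qz Fz]]; move: qz; rewrite ltNge => /negP; apply.
by apply: lb_le_inf; [exists x|exact: lb].
Unshelve. all: by end_near. Qed.

End Cdf.

(** * Threshold tests and the gap of a CND *)

Section Cnd.
Context {R : realType}.
Implicit Types (f F : R -> R).

(** The test is the indicator of []u, +oo[]: its expectation is [1 - F u] under the law of [X],
    within the budget [1 - a], and [1 - F (u - m)] under that of [X + m]. *)
Lemma tradeoff_shift_le {d : measure_display} {T : measurableType d}
    {P : probability T R} {X : {RV P >-> R}} {F} (hF : has_cdf X F) m a u :
  a <= F u -> tradeoff_shift X m a <= F (u - m).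
Proof.
move=> aF; pose D : set R := `]u, +oo[%classic.
have mD : measurable D by exact: measurable_itv.
pose phi : {mfun R >-> R} := mindic R mD.
pose Y : {RV P >-> R} := X \+ cst m.
have E1 (S : probability R R) : 'E_S[phi]%E = S D by exact: expectation_indic.
have -> : F (u - m) = 1 - fine 'E_(distribution P Y)[phi].
  have -> : 'E_(distribution P Y)[phi]%E = (1 - F (u - m))%:E.
    rewrite E1 -(cdf_gtr hF) /distribution /pushforward; congr (P _).
    by apply/seteqP; split => x; rewrite /D /= !in_itv /= !andbT; lra.
  by rewrite /=; lra.
apply: tradeoff_le.
  by move=> x; rewrite /phi /= mindicE; case: (_ \in _) => /=; lra.
have -> : 'E_(distribution P X)[phi]%E = (1 - F u)%:E.
  by rewrite E1; exact: (cdf_gtr hF).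
by rewrite lee_fin; lra.
Qed.

Lemma tradeoff_function_convex f a b l : tradeoff_function f ->
  0 <= a <= 1 -> 0 <= b <= 1 -> 0 <= l <= 1 ->
  f (l * a + (1 - l) * b) <= l * f a + (1 - l) * f b.
Proof.
move=> [d [T [P [Q fPQ]]]] a01 b01 l01.
rewrite !fPQ//; first exact: tradeoff_convex.
by case/andP: a01 => *; case/andP: b01 => *; case/andP: l01 => *; apply/andP;
  split; nra.
Qed.

(* The gap a - f a is concave and equal at a = F q and b = F (1 - q), which
   lie on both sides of F (1/2). *)
Lemma cnd_gap {d : measure_display} {T : measurableType d}
    {P : probability T R} {f F} {N : {RV P >-> R}} :
  tradeoff_function f -> cnd_rv f N F ->
  forall a, 0 < a < 1 -> a - f a <= 2 * F (1 / 2) - 1.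
Proof.
move=> tf [hF cF fge ftight fq Fsym].
have ndF := @cdf_homo _ _ _ _ _ _ hF; have F01 := cdf01 hF.
have qlt a x : 0 < a < 1 -> F x < a -> x < quantile F a.
  by move=> a01; rewrite !ltNge; rewrite (quantile_leE hF).
(* [F x] may be 0 or 1, where [cnd_tight] says nothing; [cnd_ge] with shift 1 covers all levels. *)
have fF x : f (F x) <= F (x - 1).
  apply: le_trans (fge 1 _ _ (F01 x)) _; first lra.
  exact: (tradeoff_shift_le hF).
have fquant a : 0 < a < 1 -> f a = F (quantile F a - 1).
  by move=> a01; rewrite ftight// fq.
(* Here the quantile of [a] exceeds 1/2, so [f a] is at least [F (- (1 / 2)) = 1 - F (1 / 2)]. *)
have gap_le a : F (1 / 2) < a -> a < 1 -> a - f a <= a + F (1 / 2) - 1.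
  move=> Fa a1; have := F01 (1 / 2) => F012.
  rewrite fquant; last lra.
  have := qlt a _ ltac:(lra) Fa => q.
  have := ndF (1 / 2 - 1) (quantile F a - 1) ltac:(lra).
  have := Fsym (1 / 2); have -> : - (1 / 2) = 1 / 2 - 1 :> R by lra.
  lra.
move=> a a01; set q := quantile F a; set b := F (1 - q).
have aq : a <= F q by rewrite -(quantile_leE hF).
have fa : f a = 1 - b.
  by rewrite fquant// -/q Fsym /b; congr (1 - F _); lra.
(* [f b <= F (- q) = 1 - F q <= 1 - a], so the gap at [b] is at least [a + b - 1], the gap at
   [a]. *)
have fb : f b <= b - (a + b - 1).
  have := fF (1 - q); rewrite -/b.
  have -> : 1 - q - 1 = - q by lra.
  by have := Fsym q; lra.
have b01 : 0 <= b <= 1 := F01 _.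
rewrite fa.
(* The value of f at F (1/2) is only controlled from the right, where quantiles
   exceed 1/2 even if F is flat there; hence the limit c -> F (1/2). *)
have key lo hi : 0 <= lo -> lo <= F (1 / 2) < hi -> hi <= 1 ->
    a + b - 1 <= lo - f lo -> a + b - 1 <= hi - f hi ->
    a + b <= 2 * F (1 / 2).
  move=> lo0 lohi hi1 glo ghi; apply/ler_addgt0Pr => e e0.
  (* [c] exceeds [F (1 / 2)] by at most [e] and stays below [hi], so it is a convex combination of
     [lo] and [hi]. Its gap is at least [a + b - 1] by convexity of [f] and at most
     [c + F (1 / 2) - 1] by [gap_le]. *)
  pose c := Num.min (F (1 / 2) + e) ((F (1 / 2) + hi) / 2).
  have cF12 : F (1 / 2) < c by rewrite /c lt_min; apply/andP; split; lra.
  have ce : c <= F (1 / 2) + e by rewrite /c ge_min lexx.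
  have chi : c < hi.
    by rewrite /c gt_min; apply/orP; right; lra.
  have gc := gap_le c cF12 ltac:(lra).
  pose l := (hi - c) / (hi - lo).
  have hl : l * (hi - lo) = hi - c by rewrite /l mulfVK//; lra.
  have l01 : 0 <= l <= 1.
    rewrite /l; apply/andP; split; first by apply: divr_ge0; lra.
    by rewrite ler_pdivrMr; lra.
  have cE : c = l * lo + (1 - l) * hi by lra.
  have := tradeoff_function_convex f lo hi l tf ltac:(lra) ltac:(lra) l01.
  rewrite -cE => cvx.
  have l0 : 0 <= l by lra.
  have l1 : 0 <= 1 - l by lra.
  have := ler_wpM2l l0 glo; have := ler_wpM2l l1 ghi.
  lra.
(* If [a] exceeds [F (1 / 2)], then [q > 1 / 2] and [b] lies on the other side. If neither [a] nor
   [b] exceeds it, the bound is immediate. *)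
have [ha|ha] := ltP (F (1 / 2)) a.
  have /ndF Fb : 1 - q <= 1 / 2.
    by have := qlt _ _ a01 ha; rewrite -/q; lra.
  have := key b a; rewrite -/b in Fb.
  by move=> /(_ ltac:(lra) ltac:(lra) ltac:(lra) ltac:(lra) ltac:(lra)); lra.
have [hb|hb] := ltP (F (1 / 2)) b; last lra.
have := key a b.
by move=> /(_ ltac:(lra) ltac:(lra) ltac:(lra) ltac:(lra) ltac:(lra)); lra.
Qed.

End Cnd.

(** * Laws determined by cdfs, symmetry and absolute values *)

Section Law.
Context {R : realType}.

(** The rays []x, +oo[] are stable under intersection, generate the Borel sets and exhaust the line,
    so finite measures agreeing on them coincide. *)
Lemma has_cdf_eq_in_distribution {d d' : measure_display}
    {T : measurableType d} {T' : measurableType d'} {P : probability T R}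
    {P' : probability T' R} {X : {RV P >-> R}} {Y : {RV P' >-> R}}
    {F : R -> R} :
  has_cdf X F -> has_cdf Y F -> eq_in_distribution P P' X Y.
Proof.
move=> hX hY.
apply: (@measure_unique _ R R (@RGenOInfty.G R)
  (fun n => `]- n%:R, +oo[%classic)
  _ _ _ _ (distribution P X) (distribution P' Y)).
- exact: RGenOInfty.measurableE.
- move=> _ _ [x ->] [y ->]; exists (Num.max x y).
  by rewrite predeqE => z /=; rewrite !in_itv /= !andbT gt_max; split=> /andP.
- by move=> n; exists (- n%:R).
- rewrite -subTset => x _; exists (Num.truncn `|x|).+1 => //=.
  rewrite in_itv /= andbT ltrNl (le_lt_trans (ler_norm _))// normrN.
  exact: truncnS_gt.
- move=> _ [x ->].
  transitivity (1 - F x)%:E; first exact: (cdf_gtr hX).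
  by rewrite -(cdf_gtr hY).
- move=> n; apply: le_lt_trans (probability_le1 (distribution P X) _) _.
    exact: measurable_itv.
  exact: ltry.
Qed.

Section Continuous.
Context {d : measure_display} {T : measurableType d} {P : probability T R}.
Context {X : {RV P >-> R}} {F : R -> R}.
Hypotheses (hF : has_cdf X F) (cF : continuous F).

Lemma continuous_cdf_surj v t : 0 < v <= F t -> exists2 s, s <= t & F s = v.
Proof.
move=> /andP[v0 vt]; have [x Fx] := cdf_eventually_lt hF _ v0.
have xt : x <= t.
  by rewrite leNgt; apply/negP => /ltW/(cdf_homo hF); lra.
have [||s] := @IVT R F x t v xt.
- exact: continuous_subspaceT.
- by rewrite min_l ?max_r ?vt ?(ltW Fx)// (le_trans (ltW Fx)).
- by rewrite in_itv /= => /andP[_ st] Fs; exists s.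
Qed.

(** Continuity of [F] excludes an atom at [x]: points [y < x] already carry mass [F y] arbitrarily
    close to [F x]. *)
Lemma continuous_cdf_ltr x : P (X @^-1` `]-oo, x[) = (F x)%:E.
Proof.
apply/eqP; rewrite eq_le; apply/andP; split.
  rewrite -(hF x) /cdf /distribution /pushforward.
  apply: le_measure; rewrite ?inE.
  - by apply: (measurable_funPTI X); exact: measurable_itv.
  - by apply: (measurable_funPTI X); exact: measurable_itv.
  - by move=> w /=; rewrite !in_itv /=; exact: ltW.
apply/lee_addgt0Pr => e e0.
have Fxe : F x - e < F x by lra.
have /cvg_at_left_filter/cvgr_gt/(_ _ Fxe) h := cF x.
have : \forall y \near x^'-, y < x /\ F x - e < F y.
  near=> y; split; near: y; [exact: nbhs_left_lt|exact: h].
move=> /filter_ex [y [/= yx Fy]].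
apply: (@le_trans _ _ ((F y)%:E + e%:E)%E).
  by rewrite -EFinD lee_fin; lra.
rewrite leeD2r// -(hF y) /cdf /distribution /pushforward.
apply: le_measure; rewrite ?inE.
- by apply: (measurable_funPTI X); exact: measurable_itv.
- by apply: (measurable_funPTI X); exact: measurable_itv.
- by move=> w /=; rewrite !in_itv /= => /le_lt_trans; apply.
Unshelve. all: by end_near. Qed.

(** [- X <= x] is the complement of the open event [X < - x], so the cdf identity passes to the law
    because there are no atoms. *)
Lemma symmetric_cdf_eq : (forall x, F x = 1 - F (- x)) ->
  symmetric_about_zero P X.
Proof.
move=> Fsym; have mN : measurable_fun setT (fun w => - X w).
  exact: measurable_funN.
pose Y : {RV P >-> R} := HB.pack (fun w => - X w)
  (isMeasurableFun.Build _ _ _ _ _ mN).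
apply: (has_cdf_eq_in_distribution hF : has_cdf Y F -> _) => x.
rewrite /cdf /distribution /pushforward.
have -> : Y @^-1` `]-oo, x] = ~` (X @^-1` `]-oo, - x[).
  rewrite preimage_setC setCitvl; apply/seteqP.
  by split=> w; rewrite /= !in_itv /= andbT lerNl.
rewrite probability_setC; last first.
  by apply: (measurable_funPTI X); exact: measurable_itv.
by rewrite continuous_cdf_ltr [in RHS](Fsym x) EFinB.
Qed.

(** For [x >= 0] the interval [[- x, x]] has mass [F x - F (- x) = 2 * F x - 1]; for [x < 0] this
    expression is non-positive and the maximum gives 0. *)
Lemma norm_cdf : (forall x, F x = 1 - F (- x)) ->
  forall Y : {RV P >-> R}, (forall w, Y w = `|X w|) ->
  has_cdf Y (fun x => Num.max 0 (2 * F x - 1)).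
Proof.
move=> Fsym Y YX x; have Fx := Fsym x.
rewrite /cdf /distribution /pushforward.
have [x0|x0] := ltP x 0.
  have -> : Y @^-1` `]-oo, x] = set0.
    apply/seteqP; split=> // w; rewrite /= in_itv /= YX.
    by move=> /le_lt_trans/(_ x0); rewrite normr_lt0.
  have := cdf_homo hF x (- x) ltac:(lra).
  move=> h; rewrite measure0 max_l//.
  lra.
have -> : Y @^-1` `]-oo, x] = (X @^-1` `]-oo, x]) `\` (X @^-1` `]-oo, - x[).
  apply/seteqP; split=> w; rewrite /= !in_itv /= YX ler_norml.
    by move=> /andP[a ->]; split=> //; apply/negP; rewrite -leNgt.
  by move=> [->] /negP; rewrite -leNgt andbT.
rewrite measureD; last 3 first.
- by apply: (measurable_funPTI X); exact: measurable_itv.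
- by apply: (measurable_funPTI X); exact: measurable_itv.
- rewrite -ge0_fin_numE// fin_num_measure//.
  by apply: (measurable_funPTI X); exact: measurable_itv.
rewrite setIidr; last first.
  by move=> w /=; rewrite !in_itv /= => wx; apply/ltW/(lt_le_trans wx); lra.
rewrite [A in (_ - A)%E](continuous_cdf_ltr (- x)).
rewrite [A in (A - _)%E](hF x).
have := cdf_homo hF (- x) x ltac:(lra) => ?.
by rewrite -EFinB max_r; [congr EFin|]; lra.
Qed.

End Continuous.

Lemma eq_in_distribution_norm {d d' : measure_display}
    {T : measurableType d} {T' : measurableType d'} {P : probability T R}
    {P' : probability T' R} {X : {RV P >-> R}} {Y : {RV P' >-> R}} :
  symmetric_about_zero P X -> symmetric_about_zero P' Y ->
  eq_in_distribution P P' (fun w => `|X w|) (fun w => `|Y w|) ->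
  eq_in_distribution P P' X Y.
Proof.
move=> sX sY XY A mA.
(* A `|` - A and A `&` - A are symmetric, so X belongs to them iff |X| does. *)
pose B := -%R @^-1` A : set R.
have mB : measurable B.
  by rewrite -[B]setTI; exact: measurable_funN.
(* Inclusion-exclusion for [A] and [B], which have equal mass by symmetry. *)
have sE d0 (S : measurableType d0) (Q : probability S R) (Z : {RV Q >-> R}) :
    symmetric_about_zero Q Z ->
    (Q (Z @^-1` A) + Q (Z @^-1` A) =
     Q ((fun w => `|Z w|%R) @^-1` (A `|` B)) +
     Q ((fun w => `|Z w|%R) @^-1` (A `&` B)))%E.
  move=> sZ; have QB : Q (Z @^-1` B) = Q (Z @^-1` A) by rewrite [RHS]sZ.
  have mZA : measurable (Z @^-1` A) by exact: (measurable_funPTI Z).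
  have mZB : measurable (Z @^-1` B) by exact: (measurable_funPTI Z).
  have -> : (fun w => `|Z w|) @^-1` (A `|` B) = (Z @^-1` A) `|` (Z @^-1` B).
    by apply/seteqP; split=> w /=; rewrite /B /=;
      case: (ger0P (Z w : R)) => _; rewrite ?opprK; tauto.
  have -> : (fun w => `|Z w|) @^-1` (A `&` B) = (Z @^-1` A) `&` (Z @^-1` B).
    by apply/seteqP; split=> w /=; rewrite /B /=;
      case: (ger0P (Z w : R)) => _; rewrite ?opprK; tauto.
  have QAoo : (Q (Z @^-1` A) < +oo)%E.
    by rewrite (le_lt_trans (probability_le1 _ _))// ltry.
  have QI : Q (Z @^-1` A `&` Z @^-1` B) \is a fin_num.
    by apply: fin_num_measure; exact: measurableI.
  by rewrite measureUfinl// subeK//; congr (_ + _)%E; exact: esym QB.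
have eU : P ((fun w => `|X w|) @^-1` (A `|` B)) =
    P' ((fun w => `|Y w|) @^-1` (A `|` B)) by apply: XY; exact: measurableU.
have eI : P ((fun w => `|X w|) @^-1` (A `&` B)) =
    P' ((fun w => `|Y w|) @^-1` (A `&` B)) by apply: XY; exact: measurableI.
have := sE _ _ _ _ sX; rewrite eU eI -(sE _ _ _ _ sY) /pushforward.
have /fineK <- : P (X @^-1` A) \is a fin_num.
  by apply: fin_num_measure; exact: (measurable_funPTI X).
have /fineK <- : P' (Y @^-1` A) \is a fin_num.
  by apply: fin_num_measure; exact: (measurable_funPTI Y).
by rewrite -!EFinD => -[] ?; congr EFin; lra.
Qed.

End Law.

(** * Monotone coupling through quantiles *)

Section Coupling.
Context {R : realType} {d d' : measure_display}.
Context {T : measurableType d} {T' : measurableType d'}.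
Context {P : probability T R} {P' : probability T' R}.

(** Superlevel sets inside [D] are intervals. The restriction to [D] is there because a quantile is
    monotone only on levels in []0, 1[]. *)
Lemma in_homo_measurable (D : set R) (f : R -> R) : is_interval D ->
  (forall x y, D x -> D y -> x <= y -> f x <= f y) -> measurable_fun D f.
Proof.
move=> iD ndf.
apply: (measurability (@RGenCInfty.G R)) => [|/= _ [_] [r] -> <-].
  exact: RGenCInfty.measurableE.
apply: is_interval_measurable => s t /= [Ds]; rewrite !in_itv /= !andbT => rs.
move=> [Dt rt] u su; have Du : D u by apply: iD su.
split=> //; rewrite in_itv /= andbT (le_trans rs)// ndf//.
by case/andP: su.
Qed.

(* The quantile is junk outside the levels ]0, 1[, which [G \o Y] leaves with
   probability zero; k is the identity there. *)
Lemma quantile_coupling {Y : {RV P >-> R}} {Z : {RV P' >-> R}} {G H : R -> R} :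
  has_cdf Y G -> continuous G -> has_cdf Z H -> (forall x, H x <= G x) ->
  exists k : R -> R, [/\ measurable_fun setT k, forall x, x <= k x,
    forall x, G x = 0 -> k x = x & eq_in_distribution P' P Z (k \o Y)].
Proof.
move=> hG cG hH HG.
(* The maximum matters where [G] is flat to the left of [x]: there the quantile of [H] at [G x] may
   fall below [x]. *)
pose k x := if 0 < G x < 1 then Num.max x (quantile H (G x)) else x.
have xk x : x <= k x by rewrite /k; case: ifP => // _; rewrite le_max lexx.
have ndG := cdf_homo hG.
have mG : measurable_fun setT G.
  by apply: nondecreasing_measurable => // x y /ndG.
have k_le x t : (k x <= t) = (x <= t) && ((0 < G x < 1) ==> (G x <= H t)).
  rewrite /k; case: ifP => [G01|_]; last by rewrite andbT.
  by rewrite ge_max (quantile_leE hH).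
have mk : measurable_fun setT k.
  apply: measurable_fun_if => //.
  - by apply: measurable_and; exact: measurable_fun_ltr.
  - apply: in_homo_measurable => [x z [_ /= /andP[Gx _]] [_ /= /andP[_ Gz]] y|].
      move=> /andP[xy yz]; split=> //=; apply/andP; split.
        exact: lt_le_trans Gx (ndG _ _ xy).
      exact: le_lt_trans (ndG _ _ yz) Gz.
    move=> x y [_ /= Gx] [_ /= Gy] xy.
    rewrite ge_max !le_max xy /=; apply/orP; right.
    by rewrite (quantile_leE hH)// (le_trans (ndG _ _ xy))// -(quantile_leE hH).
have mkY : measurable_fun setT (k \o Y) by exact: measurableT_comp.
have mGY : measurable_fun setT (G \o Y) by exact: measurableT_comp.
pose K : {RV P >-> R} :=
  HB.pack (k \o Y) (isMeasurableFun.Build _ _ _ _ _ mkY).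
pose U : {RV P >-> R} :=
  HB.pack (G \o Y) (isMeasurableFun.Build _ _ _ _ _ mGY).
have mpre (V : {RV P >-> R}) (i : interval R) : measurable (V @^-1` [set` i]).
  by apply: (measurable_funPTI V); exact: measurable_itv.
have hit v : 0 < v -> v < 1 -> exists r, G r = v.
  move=> v0 v1; have [x vx] := cdf_eventually_gt hG v v1.
  have [|r _] := continuous_cdf_surj hG cG v x; last by exists r.
  by rewrite v0 ltW.
(* One half of the uniformity of [U]. The slack [e] gives a positive level [c + e = G r] that [G]
   attains, and [U <= c] then forces [Y <= r]. *)
have U_le c : 0 <= c -> (P (U @^-1` `]-oo, c]) <= c%:E)%E.
  move=> c0; apply/lee_addgt0Pr => e e0; rewrite -EFinD.
  have [c1|c1] := leP 1 (c + e).
    by apply: le_trans (probability_le1 _ _) _ => //; rewrite lee_fin.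
  have [|r Gr] := hit (c + e) _ c1; first lra.
  rewrite -Gr -(hG r); apply: le_measure; rewrite ?inE //.
  move=> w; rewrite /= !in_itv /= => Uc; rewrite leNgt; apply/negP => /ltW/ndG.
  by rewrite Gr; move: Uc; rewrite /U /=; lra.
have U_ge1 : P (U @^-1` `[1, +oo[) = 0%E.
  apply/eqP; rewrite eq_le measure_ge0 andbT; apply/lee_addgt0Pr => e e0.
  rewrite add0e; have [e1|e1] := leP 1 e.
    by apply: le_trans (probability_le1 _ _) _ => //; rewrite lee_fin.
  have [||r Gr] := hit (1 - e); [lra|lra|].
  have -> : e = 1 - G r by lra.
  rewrite -(cdf_gtr hG); apply: le_measure; rewrite ?inE //.
  move=> w; rewrite /= !in_itv /= !andbT => U1; rewrite ltNge; apply/negP.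
  by move=> /ndG; move: U1; rewrite /U /=; lra.
have hK : has_cdf K H.
  move=> t; have H01 := cdf01 hH t; have HGt := HG t.
  rewrite /cdf /distribution /pushforward; apply/eqP; rewrite eq_le.
  apply/andP; split.
    (* Outside the null event [U >= 1], [K <= t] implies [U <= H t]; level 0 is included since
       [H t >= 0]. *)
    apply: (@le_trans _ _ (P (U @^-1` `]-oo, H t] `|` U @^-1` `[1, +oo[))).
      apply: le_measure; rewrite ?inE //; first exact: measurableU.
      move=> w; rewrite /= !in_itv /= andbT k_le => /andP[_ /implyP].
      rewrite /U /=; case: (leP 1 (G (Y w))) => U1; first by right.
      case: (ltP 0 (G (Y w))) => U0 h; left; first exact: h.
      by apply: le_trans U0 _; case/andP: H01.
    apply: le_trans (measureU2 _ _ _) _ => //.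
    have -> : (H t)%:E = ((H t)%:E + 0)%E by rewrite adde0.
    by apply: leeD; [apply: U_le; case/andP: H01|rewrite [leLHS]U_ge1].
  have [H0|H0] := ltP 0 (H t); last first.
    by apply: le_trans (measure_ge0 _ _); rewrite lee_fin.
  (* [H <= G] and continuity of [G] place a point [s <= t] at level [H t]; [Y <= s] then implies
     [K <= t]. *)
  have [|s st Gs] := continuous_cdf_surj hG cG (H t) t; first by rewrite H0.
  rewrite -Gs -(hG s) /cdf /distribution /pushforward.
  apply: le_measure; rewrite ?inE //.
  move=> w; rewrite /= !in_itv /= k_le => Ys; rewrite (le_trans Ys st) /=.
  by apply/implyP => _; rewrite -Gs ndG.
exists k; split=> //; last exact: (has_cdf_eq_in_distribution hH hK).
by move=> x Gx; rewrite /k Gx ltxx.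
Qed.

End Coupling.

(** * Expectations without integrability assumptions *)

Section Expectation.
Context {R : realType} {d d' : measure_display}.
Context {T : measurableType d} {T' : measurableType d'}.
Context {P : probability T R} {P' : probability T' R}.

(** Positive parts increase and negative parts decrease from [X] to [Y], and extended subtraction
    respects this even at infinite values. *)
Lemma expectation_mono (X Y : T -> R) : measurable_fun setT X ->
  measurable_fun setT Y -> (forall w, X w <= Y w) -> ('E_P[X] <= 'E_P[Y])%E.
Proof.
move=> mX mY XY; rewrite unlock integralE [leRHS]integralE.
have /measurable_EFinP mX' := mX; have /measurable_EFinP mY' := mY.
apply: leeB; apply: ge0_le_integral => //.
- exact: measurable_funepos.
- exact: measurable_funepos.
- by move=> w _; apply: (@funepos_le _ _ setT) => [v _|]; rewrite ?inE// lee_fin.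
- exact: measurable_funeneg.
- exact: measurable_funeneg.
- by move=> w _; apply: (@funeneg_le _ _ setT) => [v _|]; rewrite ?inE// lee_fin.
Qed.

(** The positive and negative parts of [h] are integrated separately against the common law, where
    change of variables needs only non-negativity. *)
Lemma expectation_eq_in_distribution {X : {RV P >-> R}} {Y : {RV P' >-> R}}
    (h : R -> R) : measurable_fun setT h -> eq_in_distribution P P' X Y ->
  'E_P[h \o X]%E = 'E_P'[h \o Y]%E.
Proof.
move=> mh XY; rewrite unlock integralE [RHS]integralE.
have eq_int (g : R -> \bar R) : measurable_fun setT g ->
    (forall x, 0 <= g x)%E ->
    (\int[P]_w g (X w) = \int[P']_w g (Y w))%E.
  move=> mg g0; transitivity (\int[distribution P X]_x g x)%E.
    by rewrite ge0_integral_distribution.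
  transitivity (\int[distribution P' Y]_x g x)%E.
    by apply: eq_measure_integral => A mA _; exact: XY.
  by rewrite ge0_integral_distribution.
have /measurable_EFinP mh' := mh.
congr (_ - _)%E.
- have mp : measurable_fun setT (EFin \o h)^\+%E by exact: measurable_funepos.
  transitivity (\int[P]_w (EFin \o h)^\+ (X w))%E.
    by apply: eq_integral => w _; rewrite !funeposE.
  rewrite (eq_int _ mp) => [|x]; last exact: funepos_ge0.
  by apply: eq_integral => w _; rewrite !funeposE.
- have mn : measurable_fun setT (EFin \o h)^\-%E by exact: measurable_funeneg.
  transitivity (\int[P]_w (EFin \o h)^\- (X w))%E.
    by apply: eq_integral => w _; rewrite !funenegE.
  rewrite (eq_int _ mn) => [|x]; last exact: funeneg_ge0.
  by apply: eq_integral => w _; rewrite !funenegE.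
Qed.

End Expectation.

(** * Interval masses, stochastic domination and its consequences *)

Lemma cnd_family_spread {R : realType} {f : R -> R -> R} {F H : R -> R}
    {d : measure_display} {T : measurableType d} {P : probability T R}
    {X : {RV P >-> R}} (t u : R) :
  (forall t : R, 0 < t -> cnd (f t) (fun x => F (t * x))) -> has_cdf X H ->
  (forall t : R, 0 <= t ->
     forall x : R, 0 <= x <= 1 -> f t x <= tradeoff_shift X t x) ->
  0 < t -> 0 <= 2 * F t - 1 -> H u - H (u - 2 * t) <= 2 * F t - 1.
Proof.
move=> hF hX hf t0 Ft.
have t2 : 0 < 2 * t by lra.
(* The CND for [f (2 * t)] is the rescaling of [F] by [2 * t], whose value at 1/2 is [F t]. *)
have [tf _ [d1 [T1 [P1 [N1 hN1]]]]] := hF _ t2.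
have gap a : 0 < a < 1 -> a <= H u -> a <= 2 * F t - 1 + H (u - 2 * t).
  move=> a01 aH; have := cnd_gap tf hN1 a a01.
  have -> : 2 * t * (1 / 2) = t by lra.
  have := hf (2 * t) ltac:(lra) a ltac:(lra).
  have := tradeoff_shift_le hX (2 * t) a u aH.
  lra.
rewrite leNgt; apply/negP => h.
have := cdf01 hX u; have := cdf01 hX (u - 2 * t) => H1 H2.
(* [H u] may be 1, which the gap bound does not cover. The midpoint lies strictly between 0 and 1,
   its positivity resting on [0 <= 2 * F t - 1]. *)
have := gap ((2 * F t - 1 + H (u - 2 * t) + H u) / 2) ltac:(lra) ltac:(lra).
lra.
Qed.

Theorem theorem16 (R : realType) (f : R -> R -> R) (F : R -> R)
  (hdiv : infinitely_divisible f)
  (hsym : forall t : R, 0 <= t -> symmetric_tradeoff (f t))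
  (hF : log_concave_cnd f F)
  (d : measure_display) (T : measurableType d) (P : probability T R)
  (N : {RV P >-> R}) (hN : has_cdf N F)
  (d' : measure_display) (T' : measurableType d') (P' : probability T' R)
  (N' : {RV P' >-> R})
  (hN' : forall t : R, 0 <= t ->
     forall x : R, 0 <= x <= 1 -> f t x <= tradeoff_shift N' t x) :
  [/\ forall a : R,
        stochastically_dominates P' P (fun w => `|N' w - a|) (fun w => `|N w|),
      forall (a t : R), 0 <= t ->
        (P' [set w | `|N' w - a| <= t]%R <= P [set w | `|N w| <= t]%R)%E,
      forall phi : R -> R,
        (forall x y : R, 0 <= x -> x <= y -> phi x <= phi y) ->
        forall a : R,
          ('E_P[fun w => phi `|N w|%R] <= 'E_P'[fun w => phi `|N' w - a|%R])%E
    & exists (d0 : measure_display) (T0 : measurableType d0)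
        (P0 : probability T0 R) (N0 W : {RV P0 >-> R}),
        [/\ eq_in_distribution P0 P N0 N,
            forall w, 0 <= W w,
            eq_in_distribution P' P0 (fun w => `|N' w|) (fun w => `|N0 w| + W w)
          & symmetric_about_zero P' N' ->
            eq_in_distribution P' P0 N'
              (fun w => N0 w + Num.sg (N0 w) * W w)]].
Proof.
have [_ hcnd] := hF.
have [cF Fsym] : continuous F /\ forall x, F x = 1 - F (- x).
  have [_ _ [d1 [T1 [P1 [N1 [_ c _ _ _ s]]]]]] := hcnd _ ltr01.
  have FE : (fun x => F (1 * x)) = F by apply/funext => x; rewrite mul1r.
  by split; [rewrite -FE|move=> x; have := s x; rewrite !mul1r].
have ndF := cdf_homo hN.
have F_ge t : 0 <= t -> 0 <= 2 * F t - 1.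
  by move=> t0; have := Fsym t; have := ndF (- t) t ltac:(lra); lra.
have mNorm d1 (S : measurableType d1) (X : S -> R) a :
    measurable_fun setT X -> measurable_fun setT (fun w => `|X w - a|).
  by move=> mX; apply: measurableT_comp => //; exact: measurable_funB.
have mAbsN : measurable_fun setT (fun w => `|N w|).
  exact: measurableT_comp.
pose Y : {RV P >-> R} := HB.pack (fun w => `|N w|)
  (isMeasurableFun.Build _ _ _ _ _ mAbsN).
pose Z a : {RV P' >-> R} := HB.pack (fun w => `|N' w - a|)
  (isMeasurableFun.Build _ _ _ _ _
    (mNorm _ _ N' a (@measurable_funPT _ _ _ _ N'))).
pose G x := Num.max 0 (2 * F x - 1).
have hG : has_cdf Y G by exact: (norm_cdf hN cF Fsym).
have cG : continuous G.
  move=> x; apply: (@continuous_max R R (fun=> 0) (fun x => 2 * F x - 1)).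
    exact: cvg_cst.
  apply: cvgB; last exact: cvg_cst.
  by apply: cvgM; [exact: cvg_cst|exact: cF].
have hH a : has_cdf (Z a) (fun x => fine (cdf (Z a) x)).
  by move=> x; rewrite fineK// fin_num_measure.
have hH' : has_cdf N' (fun x => fine (cdf N' x)).
  by move=> x; rewrite fineK// fin_num_measure.
have dom a x : fine (cdf (Z a) x) <= G x.
  have [x0|x0] := ltP x 0.
    rewrite /cdf /distribution /pushforward (_ : _ @^-1` _ = set0).
      by rewrite measure0 /= /G le_max lexx.
    apply/seteqP; split=> // w; rewrite /= in_itv /=.
    by move=> /le_lt_trans/(_ x0); rewrite normr_lt0.
  suff: fine (cdf (Z a) x) <= 2 * F x - 1 by rewrite le_max => ->; rewrite orbT.
  (* The event lies in the half-open interval []a - s, a + s]]. The margin [s > x] captures the left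
     endpoint and keeps [s] positive when [x = 0]; continuity of [F] then lets [s] decrease to
     [x]. *)
  have hs s : x < s -> fine (cdf (Z a) x) <= 2 * F s - 1.
    move=> xs; apply: le_trans (cnd_family_spread s (a + s) hcnd hH' hN' _ _).
    - rewrite -lee_fin -hH -(cdf_itv_oc hH'); last lra.
      rewrite /cdf /distribution /pushforward.
      apply: le_measure; rewrite ?inE.
      + by apply: (measurable_funPTI (Z a)); exact: measurable_itv.
      + by apply: (measurable_funPTI N'); exact: measurable_itv.
      + by move=> w; rewrite /= !in_itv /= ler_norml; lra.
    - lra.
    - by apply: F_ge; lra.
  rewrite leNgt; apply/negP => Fx.
  have /cvg_at_right_filter/cvgr_lt h := cF x.
  have : \forall s \near x^'+, x < s /\ F s < (fine (cdf (Z a) x) + 1) / 2.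
    near=> s; split; near: s; first exact: nbhs_right_gt.
    by apply: h; lra.
  by move=> /filter_ex[s [/= /hs]]; lra.
have sdom (a : R) :
    stochastically_dominates P' P (fun w => `|N' w - a|) (fun w => `|N w|).
  move=> t; have := hG t; have := hH a t.
  rewrite /cdf /distribution /pushforward => ZE YE.
  rewrite [leLHS]ZE [leRHS]YE lee_fin; exact: dom.
have coup (a : R) := quantile_coupling hG cG (hH a) (dom a).
split=> [|a t _||]; [exact: sdom|exact: sdom| |].
- move=> phi ndphi a; have [k [mk xk _ Zk]] := coup a.
  (* [phi] is arbitrary on negative reals; [psi] is monotone on the whole line, hence measurable,
     and agrees with [phi] on absolute values. *)
  pose psi x := phi (Num.max 0 x).
  have mpsi : measurable_fun setT psi.
    apply: nondecreasing_measurable => // x y xy.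
    apply: ndphi; first by rewrite le_max lexx.
    by rewrite ge_max !le_max xy lexx orbT.
  have psiE x : phi `|x| = psi `|x| by rewrite /psi max_r.
  have mkY : measurable_fun setT (k \o Y) by exact: measurableT_comp.
  pose K : {RV P >-> R} :=
    HB.pack (k \o Y) (isMeasurableFun.Build _ _ _ _ _ mkY).
  have -> : (fun w => phi `|N w|) = psi \o Y by apply/funext => w; exact: psiE.
  have -> : (fun w => phi `|N' w - a|) = psi \o Z a.
    by apply/funext => w; exact: psiE.
  rewrite (@expectation_eq_in_distribution _ _ _ _ _ _ _ (Z a) K psi mpsi Zk).
  apply: expectation_mono => [||w].
  - exact: measurableT_comp.
  - exact: measurableT_comp.
  - apply: ndphi; first by rewrite le_max lexx.
    by rewrite ge_max !le_max xk lexx orbT.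
- have [k [mk xk k0 Zk]] := coup 0.
  (* At the origin the sign vanishes, so [habs] below requires [k 0 = 0]; it holds because
     [F 0 = 1/2] gives [G 0 = 0]. *)
  have k00 : k 0 = 0.
    by apply: k0; rewrite /G max_l//; have := Fsym 0; rewrite oppr0; lra.
  have mW : measurable_fun setT (fun w => k `|N w| - `|N w|).
    by apply: measurable_funB => //; exact: (measurableT_comp mk mAbsN).
  pose W : {RV P >-> R} := HB.pack (fun w => k `|N w| - `|N w|)
    (isMeasurableFun.Build _ _ _ _ _ mW).
  have absZ : (fun w => `|N' w|) = Z 0 :> (_ -> _).
    by apply/funext => w /=; rewrite subr0.
  exists d, T, P, N, W; split=> //.
  - by move=> w; rewrite /= subr_ge0.
  - rewrite absZ (_ : (fun w => _ + _) = k \o Y)//.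
    by apply/funext => w /=; rewrite addrC subrK.
  move=> symN'.
  (* The odd extension of [k]: [h \o N] is the claimed sum and is symmetric like [N], so comparing
     absolute values with [N'] suffices. *)
  pose h x := x + Num.sg x * (k `|x| - `|x|).
  have hodd x : h (- x) = - h x by rewrite /h sgrN normrN; lra.
  have habs x : `|h x| = k `|x|.
    have kx : `|x| <= k `|x| := xk _.
    rewrite /h; have [x0|x0|->] := ltrgt0P x; last first.
    - by rewrite sgr0 mul0r addr0 normr0.
    - rewrite ltr0_sg// ltr0_norm; move: kx; rewrite ltr0_norm//; lra.
    - rewrite gtr0_sg// gtr0_norm; move: kx; rewrite gtr0_norm//; lra.
  have mh : measurable_fun setT h.
    apply: measurable_funD => //; apply: measurable_funM; last first.
      by apply: measurable_funB => //; exact: measurableT_comp.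
    apply: nondecreasing_measurable => // x y xy.
    have [x0|x0|x0] := ltrgt0P x; have [y0|y0|y0] := ltrgt0P y;
      rewrite ?(gtr0_sg x0) ?(ltr0_sg x0) ?(gtr0_sg y0) ?(ltr0_sg y0) ?x0 ?y0;
      rewrite ?sgr0; lra.
  have mV : measurable_fun setT (h \o N) by exact: measurableT_comp.
  pose V : {RV P >-> R} :=
    HB.pack (h \o N) (isMeasurableFun.Build _ _ _ _ _ mV).
  have symV : symmetric_about_zero P V.
    move=> A mA; have mhA : measurable (h @^-1` A).
      by rewrite -[_ @^-1` _]setTI; exact: mh.
    have := symmetric_cdf_eq hN cF Fsym _ mhA.
    rewrite /pushforward => e; transitivity (P (N @^-1` (h @^-1` A))) => //.
    rewrite e; congr (P _); apply/seteqP.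
    by split=> w /=; rewrite hodd.
  apply: (eq_in_distribution_norm symN' symV).
  rewrite absZ (_ : (fun w => `|V w|) = k \o Y)//.
  by apply/funext => w; exact: habs.
Unshelve. all: by end_near. Qed.
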